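(* Let $p=(p_n)_{n\in\mathbb{N}_0}$ and $q=(q_n)_{n\in\mathbb{N}_0}$ be sequences of non-negative real numbers, and let $t_0\in(0,\infty]$ be such that the power series $$u(t)=\sum_{n=1}^\infty p_nt^n,\qquad v(t)=\sum_{n=0}^\infty q_nt^n$$ converge to finite values for all $t\in[0,t_0)$. Assume that $p_0=0$, $v\not\equiv0$ and $\lim_{t\uparrow t_0}u(t)=\infty$ (so that $u:[0,t_0)\to[0,\infty)$ is a bijection). Let $b_n$, $B$ and $w_\theta$ be defined from $p,q$ as in the context. For $n\in B$ and $k\in\mathbb{N}_0$ put $$c_n(k):=\frac{1}{b_n\,k!\,2^k}\sum_{\ell=2k}^{n}p_\ell^{*2k}q_{n-\ell}\quad\text{if } n\ge 2k,\qquad c_n(k):=0\quad\text{otherwise}.$$ For $n\in\mathbb{N}_0$ with $n\notin B$, let $c_n$ be an arbitrary probability mass function on $\mathbb{N}_0$. For $\delta\neq0$ let $\theta=u^{-1}(|\delta|)\in(0,t_0)$, put $\eta=u^2(\theta)/2$ and define $m_\eta$ by $$m_\eta(n):=w_\theta(n),\qquad n\in\mathbb{N}_0$$ (equivalently, for each $\eta>0$, $m_\eta:=w_\theta$ with $\theta=u^{-1}(\sqrt{2\eta})$). Then the families $\{c_n:\ n\in\mathbb{N}_0\}$ and $\{m_\eta:\ \eta>0\}$ provide a mixture representation of the Poisson family; that is, all $c_n$ and all $m_\eta$ are probability mass functions on $\mathbb{N}_0$, and $$e^{-\eta}\frac{\eta^k}{k!}=\sum_{n=0}^\infty m_\eta(n)\,c_n(k)\qquad\text{for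 all }k\in\mathbb{N}_0,\ \eta>0.$$
   Context: $\mathbb{N}=\{1,2,\ldots\}$, $\mathbb{N}_0=\{0,1,2,\ldots\}$. For $k\in\mathbb{N}$ and $n\ge k$ put $$p_n^{*k}:=\sum_{\substack{(j_1,\dots,j_k)\in\mathbb{N}^k\\ j_1+\cdots+j_k=n}}p_{j_1}\cdots p_{j_k},$$ so that $u^k(t)=\sum_{n=k}^\infty p_n^{*k}t^n$; further $p_0^{*0}:=1$ and $p_j^{*0}:=0$ for $j\in\mathbb{N}$. Here $u^k(t)=(u(t))^k$. Definitions: $$b_n:=\sum_{k=0}^{\lfloor n/2\rfloor}\Bigl(\sum_{\ell=2k}^{n}p_\ell^{*2k}q_{n-\ell}\Bigr)\frac{1}{k!\,2^k},\quad n\in\mathbb{N}_0,\qquad B:=\{n\in\mathbb{N}_0:\ b_n>0\},$$ $$w_\theta(n):=\frac{1}{v(\theta)}\exp\bigl(-u^2(\theta)/2\bigr)\,b_n\,\theta^n,\quad n\in\mathbb{N}_0,\ \theta\in(0,t_0).$$ A mixture representation of the Poisson family consists of two families of probability mass functions on $\mathbb{N}_0$, $\{c_n: n\in\mathbb{N}_0\}$ and $\{m_\eta:\eta>0\}$, such that $e^{-\eta}\eta^k/k!=\sum_{n=0}^\infty m_\eta(n)c_n(k)$ for all $k\in\mathbb{N}_0$ and $\eta>0$. *)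

(* Defs.v *)
From HB Require Import structures.
From mathcomp Require Import all_boot all_order all_algebra.
From mathcomp Require Import all_classical all_reals all_analysis.
Set Implicit Arguments.
Unset Strict Implicit.
Unset Printing Implicit Defensive.
Import Order.TTheory GRing.Theory Num.Theory.
Import numFieldNormedType.Exports.
Local Open Scope classical_set_scope.
Local Open Scope ring_scope.

Section Defs.
Context {R : realType}.
Implicit Types (p q f : nat -> R) (t theta eta : R) (n k : nat).

(* The real half-open interval [0, t0), where t0 may be +oo. *)
Definition dom (t0 : \bar R) : set R := [set t | 0 <= t /\ (t%:E < t0)%E].

(* Partial sums of u(t), a series that starts at index 1. *)
Definition upartial p t : nat -> R :=
  fun N => \sum_(1 <= n < N) p n * t ^+ n.

Definition u p t : R := limn (upartial p t).

Definition v q t : R := limn (pseries q t).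

(* f t --> +oo as t increases to t0, for finite or infinite t0. *)
Definition left_lim_pinfty (t0 : \bar R) (f : R -> R) : Prop :=
  match t0 with
  | r%:E => f t @[t --> r^'-] --> +oo
  | +oo%E => f t @[t --> +oo] --> +oo
  | -oo%E => False
  end.

(* p_n^{*k}: each j in N^k with sum n has all its entries at most n, so the
   k-tuples are taken in 'I_n.+1. For k = 0 the only tuple is the empty one and
   the value is 1 if n = 0 and 0 otherwise. *)
Definition convpow p k n : R :=
  \sum_(j : {ffun 'I_k -> 'I_n.+1} |
        [forall i, (0 < j i)%N] && (\sum_i j i == n)%N)
    \prod_i p (j i).

Lemma convpow0 p n : convpow p 0 n = (n == 0%N)%:R.
Proof.
rewrite /convpow; have [->|n0] := eqVneq n 0%N.
- rewrite (big_pred1 [ffun=> ord0]) ?big_ord0// => j /=.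
  have -> : j = [ffun=> ord0] by apply/ffunP => -[].
  by rewrite eqxx big_ord0 eqxx andbT; apply/forallP => -[].
- by rewrite big_pred0// => j; rewrite big_ord0 eq_sym (negbTE n0) andbF.
Qed.

Definition convsum p q k n : R :=
  \sum_(2 * k <= l < n.+1) convpow p (2 * k) l * q (n - l)%N.

Definition b p q n : R :=
  \sum_(0 <= k < (n %/ 2).+1) convsum p q k n * (k`!%:R * 2 ^+ k)^-1.

Definition B p q : set nat := [set n | 0 < b p q n].

Definition w p q theta n : R :=
  (v q theta)^-1 * expR (- (u p theta) ^+ 2 / 2) * b p q n * theta ^+ n.

(* Inverse of u : [0, t0) -> [0, +oo). *)
Definition uinv p (t0 : \bar R) : R -> R := 'pinv_(fun=> 0) (dom t0) (u p).

Definition c_on_B p q n k : R :=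
  if (2 * k <= n)%N
  then (b p q n * k`!%:R * 2 ^+ k)^-1 * convsum p q k n
  else 0.

(* eta = u(theta)^2 / 2 with theta = u^{-1}(|delta|), delta <> 0, means
   theta = u^{-1}(sqrt (2 eta)). *)
Definition m p q (t0 : \bar R) eta n : R :=
  w p q (uinv p t0 (Num.sqrt (2 * eta))) n.

Definition is_pmf f : Prop :=
  (forall n, 0 <= f n) /\ (series f @ \oo --> (1 : R)).

Definition poisson_mixture_representation
    (c : nat -> nat -> R) (mm : R -> nat -> R) : Prop :=
  [/\ forall n, is_pmf (c n),
      forall eta, 0 < eta -> is_pmf (mm eta) &
      forall (k : nat) eta, 0 < eta ->
        series (fun n => mm eta n * c n k) @ \oo
          --> expR (- eta) * eta ^+ k / k`!%:R].

End Defs.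

(* Main.v *)
Require Import Defs.
From HB Require Import structures.
From mathcomp Require Import all_boot all_order all_algebra.
From mathcomp Require Import all_classical all_reals all_analysis.
From mathcomp Require Import lra ring.
Set Implicit Arguments.
Unset Strict Implicit.
Unset Printing Implicit Defensive.
Import Order.TTheory GRing.Theory Num.Theory.
Import numFieldNormedType.Exports.
Local Open Scope classical_set_scope.
Local Open Scope ring_scope.

(** The proof rests on one generating function identity. Since [p 0 = 0], the
    convolution powers are the coefficients of the powers of [u], so for
    [theta] in the domain

      [\sum_n convsum p q k n * theta ^ n = u(theta) ^ (2 k) * v(theta)].

    The factor [b_n] in [w_theta(n)] cancels the factor [1 / b_n] in [c_n(k)];
    where it cannot, [b_n = 0], and then every [convsum p q k n] is zero because
    [b_n] is a combination of these nonnegative numbers with positive weights.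
    In both cases [w_theta(n) c_n(k)] is [convsum p q k n * theta ^ n] times
    [exp (- u^2 / 2) / (v k! 2^k)] evaluated at [theta] ([w_mul_c]). Summing
    over [n], the generating function turns this into the Poisson weight with
    parameter [eta = u(theta)^2 / 2] ([series_w_mul_c]).

    That [m_eta] has mass 1 is then a consequence of the mixture identity: each
    [c_n] has mass 1, so the mass of [m_eta] is the double sum of
    [m_eta(n) c_n(k)], which, summed first over [n], is the total mass of the
    Poisson law ([mixing_weights_pmf]).

    The analytic input is the exchange of summations for nonnegative double
    series ([nonneg_series_interchange]), from which the Cauchy product also
    follows, and the surjectivity of [u] onto the nonnegative reals ([u_surj]),
    by the intermediate value theorem, which provides [theta] as a preimage of
    [sqrt (2 eta)]. *)

(** * Series with nonnegative terms *)

(** Bridge to the extended reals, where nonnegative series always have a sum. *)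
Lemma series_cvg_EFin (R : realType) (f : nat -> R) (s : R) :
  (forall n, 0 <= f n) ->
  (series f @ \oo --> s) <-> (\sum_(0 <= n <oo) (f n)%:E = s%:E)%E.
Proof.
move=> f0.
have E : (fun N => \sum_(0 <= n < N) (f n)%:E)%E = EFin \o series f.
  by apply/funext => N; rewrite sumEFin.
split=> [fs|].
  by apply/cvg_lim => //; rewrite E; apply: cvg_EFin => //; exact: nearW.
move=> fs.
have : cvgn (fun N => \sum_(0 <= n < N) (f n)%:E)%E.
  by apply: is_cvg_nneseries => n _ _; rewrite lee_fin.
by rewrite /= fs E => /fine_cvgP[].
Qed.

(** Tonelli for the counting measure; convergence of [series d] is part of the
    conclusion. *)
Lemma nonneg_series_interchange (R : realType) (f : nat -> nat -> R)
    (a d : nat -> R) (s : R) :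
  (forall i n, 0 <= f i n) ->
  (forall i, series (f i) @ \oo --> a i) ->
  (forall n, series (f^~ n) @ \oo --> d n) ->
  series a @ \oo --> s -> series d @ \oo --> s.
Proof.
move=> f0 fa fd as_.
have lim_ge0 (g : nat -> R) l : (forall n, 0 <= g n) ->
    series g @ \oo --> l -> 0 <= l.
  move=> g0 gl; rewrite -(cvg_lim (@Rhausdorff R) gl); apply: limr_ge.
    by apply/cvg_ex; exists l.
  by apply: nearW => N; exact: sumr_ge0.
have a0 i : 0 <= a i by apply: lim_ge0 (fa i).
have d0 n : 0 <= d n by apply: lim_ge0 (fd n).
apply/series_cvg_EFin => //; move/series_cvg_EFin : as_ => <- //.
transitivity (\sum_(0 <= n <oo) \sum_(0 <= i <oo) (f i n)%:E)%E.
  apply: eq_eseriesr => n _; apply/esym.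
  by apply/(@series_cvg_EFin _ (f^~ n)) => //; exact: fd.
rewrite nneseries_interchange; last by move=> *; rewrite lee_fin.
apply: eq_eseriesr => i _.
by apply/(@series_cvg_EFin _ (f i)) => //; exact: fa.
Qed.

Lemma series_finite_support (R : realType) (f : nat -> R) N :
  (forall n, (N <= n)%N -> f n = 0) ->
  series f @ \oo --> \sum_(0 <= n < N) f n.
Proof.
move=> fN; apply: cvg_near_cst; near=> m.
have Nm : (N <= m)%N by near: m; exact: nbhs_infty_ge.
rewrite /series /= (big_cat_nat (n := N))//= [X in _ + X]big_nat.
by rewrite [X in _ + X]big1 ?addr0// => i /andP[/fN].
Unshelve. all: by end_near. Qed.

Lemma cvg_seriesMl (R : realType) (f : nat -> R) (l c : R) :
  series f @ \oo --> l -> series (fun n => c * f n) @ \oo --> c * l.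
Proof.
move=> fl; have -> : series (fun n => c * f n) = fun N => c * series f N.
  by apply/funext => N; rewrite /series /= big_distrr.
exact: cvgMl_tmp.
Qed.

Definition cauchy_prod (R : realType) (a d : nat -> R) n : R :=
  \sum_(0 <= i < n.+1) a i * d (n - i)%N.

(** Mertens' theorem for nonnegative series: arrange the products [a i * d j] in
    a double array whose entry [(i, i + j)] is [a i * d j]. The rows sum to
    [a i * D] and the columns are the terms of the Cauchy product. *)
Lemma cvg_series_cauchy_prod (R : realType) (a d : nat -> R) (A D : R) :
  (forall n, 0 <= a n) -> (forall n, 0 <= d n) ->
  series a @ \oo --> A -> series d @ \oo --> D ->
  series (cauchy_prod a d) @ \oo --> A * D.
Proof.
move=> a0 d0 aA dD.
pose f i n := if (i <= n)%N then a i * d (n - i)%N else 0.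
apply: (@nonneg_series_interchange _ f (fun i => a i * D)).
- by move=> i n; rewrite /f; case: ifP => // _; exact: mulr_ge0.
  (* Row [i] is the series of [a i * d n] preceded by [i] zeros. *)
- move=> i; rewrite -(cvg_shiftn i).
  have -> : (fun n => series (f i) (n + i)%N) = series (fun n => a i * d n).
    apply/funext => n; rewrite /series /= (big_cat_nat (n := i))//= ?leq_addl//.
    rewrite [X in X + _]big_nat [X in X + _]big1 ?add0r; last first.
      by move=> j /andP[_ ji]; rewrite /f leqNgt ji.
    rewrite -{1}(add0n i) big_addn addnK; apply: eq_bigr => j _.
    by rewrite /f leq_addl addnK.
  exact: cvg_seriesMl.
- move=> n.
  have -> : cauchy_prod a d n = \sum_(0 <= i < n.+1) f i n.
    by apply: eq_big_nat => i /andP[_ i_n]; rewrite /f -ltnS i_n.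
  by apply: series_finite_support => i n_i; rewrite /f leqNgt n_i.
- under eq_fun do rewrite mulrC.
  by rewrite mulrC; exact: cvg_seriesMl.
Qed.

(** * Convolution powers *)

(** Multiplying out the [k]-th power of the truncated generating polynomial
    gives one monomial per [k]-tuple. The tuples with a zero entry, which [convpow]
    leaves out, contribute nothing since [p 0 = 0]. *)
Lemma convpow_coef (R : realType) (p : nat -> R) k n : p 0%N = 0 ->
  convpow p k n = ((\poly_(i < n.+1) p i) ^+ k)`_n.
Proof.
move=> p0; rewrite poly_def -[X in _ ^+ X]card_ord -prodr_const.
rewrite bigA_distr_bigA coef_sum /convpow big_mkcond/=; apply: eq_bigr => j _.
have -> : \prod_i (p (j i) *: 'X^(j i)) =
    (\prod_i p (j i)) *: 'X^(\sum_i j i) :> {poly R}.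
  by rewrite scaler_prod; congr (_ *: _); rewrite expr_sum.
rewrite coefZ coefXn eq_sym.
case: (_ =P _) => _; rewrite ?mulr1 ?mulr0 ?andbT ?andbF//.
case: forallP => // /forallP; rewrite negb_forall => /existsP[i].
by rewrite -eqn0Ngt => /eqP ji; rewrite (bigD1 i)//= ji p0 mul0r.
Qed.

(** Lets the truncation degree in [convpow_coef] be raised beyond the index of
    the coefficient. *)
Lemma coef_exp_eq (R : nzRingType) (P Q : {poly R}) k m :
  (forall i, (i <= m)%N -> P`_i = Q`_i) ->
  forall i, (i <= m)%N -> (P ^+ k)`_i = (Q ^+ k)`_i.
Proof.
move=> PQ; elim: k => [|k ih] i im; first by rewrite !expr0.
rewrite !exprS !coefM; apply: eq_bigr => -[j /= ji] _.
by rewrite PQ ?ih//; [exact: leq_trans (leq_subr _ _) im|exact: leq_trans im].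
Qed.

(** The tuples counted by [convpow p k n] have entries in ['I_n.+1], a type that
    varies with [n]; going through polynomial coefficients avoids moving tuples
    between these types when the first entry is split off. *)
Lemma convpowS (R : realType) (p : nat -> R) k n : p 0%N = 0 ->
  convpow p k.+1 n = cauchy_prod p (convpow p k) n.
Proof.
move=> p0; rewrite convpow_coef// exprS coefM /cauchy_prod big_mkord.
apply: eq_bigr => -[i /= i_n] _; rewrite convpow_coef// coef_poly i_n.
congr (_ * _); apply: (@coef_exp_eq _ _ _ _ (n - i)) => // j jn.
by rewrite !coef_poly !ltnS jn (leq_trans jn (leq_subr _ _)).
Qed.

Lemma convpow_ge0 (R : realType) (p : nat -> R) k n :
  (forall j, 0 <= p j) -> 0 <= convpow p k n.
Proof. by move=> p0; apply: sumr_ge0 => j _; exact: prodr_ge0. Qed.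

Lemma convpow_eq0 (R : realType) (p : nat -> R) k n :
  (n < k)%N -> convpow p k n = 0.
Proof.
move=> nk; rewrite /convpow big_pred0// => j; apply/negbTE/negP.
move=> /andP[/forallP j0 /eqP jn]; move: nk; rewrite -jn ltnNge => /negP; apply.
by rewrite -{1}(card_ord k) -sum1_card; apply: leq_sum => i _; exact: j0.
Qed.

(** The indices [l < 2 k] missing from [convsum] carry a zero factor. *)
Lemma convsum_cauchy_prod (R : realType) (p q : nat -> R) k n :
  convsum p q k n = cauchy_prod (convpow p (2 * k)) q n.
Proof.
rewrite /convsum /cauchy_prod; have [kn|nk] := leqP (2 * k) n.+1; last first.
  rewrite big_geq 1?ltnW//; apply/esym.
  rewrite big_nat big1// => i /andP[_ i_n].
  by rewrite convpow_eq0 ?mul0r// (leq_trans i_n)// ltnW.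
rewrite [RHS](big_cat_nat (n := (2 * k)%N))//= [X in X + _]big_nat.
rewrite [X in X + _]big1 ?add0r// => i /andP[_ ik].
by rewrite convpow_eq0 ?mul0r.
Qed.

(** * Power series with nonnegative coefficients *)

Lemma nondecreasing_pseries (R : realType) (a : nat -> R) t :
  (forall n, 0 <= a n) -> 0 <= t -> nondecreasing_seq (pseries a t).
Proof.
move=> a0 t0; apply/nondecreasing_seqP => n.
by rewrite /pseries /series/= big_nat_recr//= lerDl mulr_ge0// exprn_ge0.
Qed.

(** On [[0, T]] the remainder is largest at the right end point. *)
Lemma pseries_tail (R : realType) (a : nat -> R) (T t : R) N :
  (forall n, 0 <= a n) -> cvgn (pseries a T) -> 0 <= t <= T ->
  0 <= limn (pseries a t) - pseries a t N <= limn (pseries a T) - pseries a T N.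
Proof.
move=> a0 aT /andP[t0 tT].
have T0 := le_trans t0 tT.
have at_ : cvgn (pseries a t).
  apply: series_le_cvg aT => n; rewrite ?mulr_ge0 ?exprn_ge0//.
  by rewrite ler_wpM2l// lerXn2r.
apply/andP; split.
  rewrite subr_ge0; apply: nondecreasing_cvgn_le => //.
  exact: nondecreasing_pseries.
rewrite lerBlDr; apply: limr_le => //; near=> n.
have Nn : (N <= n)%N by near: n; exact: nbhs_infty_ge.
have SnT : pseries a T n <= limn (pseries a T).
  by apply: nondecreasing_cvgn_le => //; exact: nondecreasing_pseries.
suff : pseries a T N - pseries a t N <= pseries a T n - pseries a t n by lra.
rewrite -!sumrB [leRHS](big_cat_nat (n := N))//= lerDl; apply: sumr_ge0 => i _.
by rewrite subr_ge0 ler_wpM2l// lerXn2r.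
Unshelve. all: by end_near. Qed.

(** Uniform convergence on [[0, T]]: both remainders lie between 0 and the
    remainder at [T], so they differ by less than [e / 2], and a partial sum is
    a polynomial. Unlike the term by term differentiation of power series, this
    includes the end point [T]. *)
Lemma pseries_continuous (R : realType) (a : nat -> R) (T : R) :
  (forall n, 0 <= a n) -> cvgn (pseries a T) ->
  {within `[0, T], continuous (fun t => limn (pseries a t))}.
Proof.
move=> a0 aT; apply/subspace_continuousP => x /=; rewrite in_itv/= => xT.
apply/cvgrPdist_lt => e e0.
have e2 : 0 < e / 2 by rewrite divr_gt0.
have /cvgrPdist_lt /(_ _ e2) [N _ /(_ N (leqnn N))/=] := aT.
set tl := _ - _ => tle.
have /(_ x) : continuous (horner (\poly_(i < N) a i)).
  exact: continuous_horner.
have hE t : (\poly_(i < N) a i).[t] = pseries a t N.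
  by rewrite horner_poly /pseries /series /= big_mkord.
move/cvgrPdist_lt => /(_ _ e2) hx.
rewrite near_withinE; near=> t => /=; rewrite in_itv/= => tT.
have : `|pseries a x N - pseries a t N| < e / 2 by rewrite -!hE; near: t.
have /andP[] := pseries_tail N a0 aT xT.
have /andP[] := pseries_tail N a0 aT tT.
rewrite -/tl !ltr_norml; move: tle; rewrite ltr_norml.
by rewrite /from_subspace; clear; lra.
Unshelve. all: by end_near. Qed.

(** * The inverse of [u] *)

Lemma upartialE (R : realType) (p : nat -> R) t :
  p 0%N = 0 -> upartial p t = pseries p t.
Proof.
move=> p0; apply/funext => -[|N]; rewrite /upartial /pseries /series/=.
  by rewrite !big_geq.
by rewrite [RHS]big_ltn// p0 mul0r add0r.
Qed.

Lemma u_at0 (R : realType) (p : nat -> R) : p 0%N = 0 -> u p 0 = 0.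
Proof.
move=> p0; rewrite /u upartialE//; apply/cvg_lim => //.
have -> : pseries p 0 = fun=> 0.
  apply/funext => N; rewrite /pseries /series/= big1// => -[|n] _.
    by rewrite p0 mul0r.
  by rewrite exprS mul0r mulr0.
exact: cvg_cst.
Qed.

Lemma u_gt (R : realType) (p : nat -> R) (t0 : \bar R) y :
  (0 < t0)%E -> left_lim_pinfty t0 (u p) -> exists2 t, dom t0 t & y < u p t.
Proof.
case: t0 => [r| |]//; rewrite ?lte_fin => r0 /= /cvgryPgt /(_ y) uy.
- near r^'- => t; exists t; last by near: t.
  split; last by rewrite lte_fin; near: t; exact: nbhs_left_lt.
  by near: t; exact: nbhs_left_ge.
- near (+oo : set_system R) => t; exists t; last by near: t.
  split; last by rewrite ltry.
  by near: t; exact: nbhs_pinfty_ge.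
Unshelve. all: by end_near. Qed.

Lemma u_surj (R : realType) (p : nat -> R) (t0 : \bar R) y :
  (forall n, 0 <= p n) -> p 0%N = 0 -> (0 < t0)%E ->
  (forall t, dom t0 t -> cvgn (upartial p t)) -> left_lim_pinfty t0 (u p) ->
  0 <= y -> exists2 t, dom t0 t & u p t = y.
Proof.
move=> p_ge0 p0 t00 ucvg ulim y0.
have [T domT yT] := u_gt y t00 ulim; have [T0 Tt0] := domT.
have uE t : u p t = limn (pseries p t) by rewrite /u upartialE.
have pT : cvgn (pseries p T) by rewrite -upartialE//; exact: ucvg.
have [||t] := @IVT R (u p) 0 T y T0.
- rewrite (_ : u p = fun t => limn (pseries p t)); last exact/funext.
  exact: pseries_continuous.
- by rewrite u_at0// ge_min y0 le_max (ltW yT) orbT.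
rewrite in_itv/= => /andP[t_ge0 tT] <-; exists t => //; split => //.
by apply: le_lt_trans Tt0; rewrite lee_fin.
Qed.

Lemma uinvK (R : realType) (p : nat -> R) (t0 : \bar R) y :
  (exists2 t, dom t0 t & u p t = y) ->
  dom t0 (uinv p t0 y) /\ u p (uinv p t0 y) = y.
Proof.
move=> [t dt ty]; have yU : ([set u p x | x in dom t0] : set R) y by exists t.
split; last by rewrite /uinv pinvK// inE.
apply: (surjpinv_image_sub (B := [set u p x | x in dom t0]) (f := u p)) => //.
by exists y.
Qed.

(** * Generating functions of [convpow] and [convsum] *)

Section GeneratingFunctions.
Context (R : realType) (p q : nat -> R) (theta : R).
Context (p_ge0 : forall n, 0 <= p n) (q_ge0 : forall n, 0 <= q n)
  (p0 : p 0%N = 0) (theta_ge0 : 0 <= theta)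
  (u_cvg : cvgn (upartial p theta)) (v_cvg : cvgn (pseries q theta)).

Lemma cauchy_prodX (a d : nat -> R) n :
  cauchy_prod a d n * theta ^+ n =
  cauchy_prod (fun i => a i * theta ^+ i) (fun i => d i * theta ^+ i) n.
Proof.
rewrite /cauchy_prod big_distrl; apply: eq_big_nat => i /andP[_ i_n].
by rewrite mulrACA -exprD subnKC.
Qed.

Lemma pseries_convpow k : pseries (convpow p k) theta @ \oo --> u p theta ^+ k.
Proof.
elim: k => [|k ih].
  rewrite expr0 /pseries; under eq_fun do rewrite convpow0.
  have := @series_finite_support R (fun n => (n == 0%N)%:R * theta ^+ n) 1.
  by rewrite big_nat1 eqxx mul1r; apply=> -[|n]// _; rewrite mul0r.
rewrite exprS /pseries; under eq_fun do rewrite convpowS// cauchy_prodX.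
apply: cvg_series_cauchy_prod => //.
- by move=> n; rewrite mulr_ge0// exprn_ge0.
- by move=> n; rewrite mulr_ge0// ?exprn_ge0// convpow_ge0.
- by move: u_cvg; rewrite /u upartialE.
Qed.

Lemma pseries_convsum k :
  pseries (convsum p q k) theta @ \oo --> u p theta ^+ (2 * k) * v q theta.
Proof.
rewrite /pseries; under eq_fun do rewrite convsum_cauchy_prod cauchy_prodX.
apply: cvg_series_cauchy_prod => //.
- by move=> n; rewrite mulr_ge0// ?exprn_ge0// convpow_ge0.
- by move=> n; rewrite mulr_ge0// exprn_ge0.
- exact: pseries_convpow.
Qed.
End GeneratingFunctions.

(** * The mixing weights and the mixed distributions *)

(** Here [theta > 0] is essential: [v] vanishes at 0 when [q 0 = 0]. *)
Lemma v_gt0 (R : realType) (q : nat -> R) t theta :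
  (forall n, 0 <= q n) -> v q t != 0 -> 0 < theta -> cvgn (pseries q theta) ->
  0 < v q theta.
Proof.
move=> q0 vt th0 vth.
have [n qn] : exists n, q n != 0.
  apply: contrapT => /forallNP qe; move/eqP: vt; apply; apply/cvg_lim => //.
  have -> : pseries q t = fun=> 0.
    apply/funext => N; rewrite /pseries /series/= big1// => i _.
    by have /negP := qe i; rewrite negbK => /eqP ->; rewrite mul0r.
  exact: cvg_cst.
have nd := nondecreasing_pseries q0 (ltW th0).
apply: lt_le_trans (nondecreasing_cvgn_le nd vth n.+1).
rewrite /pseries /series/= big_nat_recr//= ltr_wpDl//.
  by apply: sumr_ge0 => i _; rewrite mulr_ge0// exprn_ge0// ltW.
by rewrite mulr_gt0 ?exprn_gt0// lt0r qn q0.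
Qed.

Section Mixing.
Context (R : realType) (p q : nat -> R).
Context (p_ge0 : forall n, 0 <= p n) (q_ge0 : forall n, 0 <= q n).

Lemma convsum_ge0 k n : 0 <= convsum p q k n.
Proof. by apply: sumr_ge0 => l _; rewrite mulr_ge0// convpow_ge0. Qed.

Lemma convsum_eq0 k n : (n < 2 * k)%N -> convsum p q k n = 0.
Proof. by move=> nk; rewrite /convsum big_geq. Qed.

Lemma fact2X_gt0 k : 0 < k`!%:R * 2 ^+ k :> R.
Proof. by rewrite mulr_gt0 ?exprn_gt0// ltr0n fact_gt0. Qed.

Lemma b_ge0 n : 0 <= b p q n.
Proof.
apply: sumr_ge0 => k _.
by rewrite mulr_ge0 ?convsum_ge0// invr_ge0 ltW// fact2X_gt0.
Qed.

Lemma notB_b0 n : ~ B p q n -> b p q n = 0.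
Proof.
by move=> nB; apply/eqP; move/negP: nB; rewrite lt0r b_ge0 andbT negbK.
Qed.

Lemma b0_convsum0 n k : b p q n = 0 -> convsum p q k n = 0.
Proof.
have [kn|nk] := leqP (2 * k) n; last by rewrite convsum_eq0.
move=> /eqP; rewrite psumr_eq0; last first.
  by move=> i _; rewrite mulr_ge0 ?convsum_ge0// invr_ge0 ltW// fact2X_gt0.
move=> /allP /(_ k); rewrite mem_index_iota /= ltnS leq_divRL// mulnC kn.
move=> /(_ isT).
by rewrite mulf_eq0 invr_eq0 (gt_eqF (fact2X_gt0 k)) orbF => /eqP.
Qed.

(** One formula covers both cases of [c_on_B], as [convsum] vanishes for
    [n < 2 k]. *)
Lemma c_on_BE n k :
  c_on_B p q n k = (b p q n)^-1 * (convsum p q k n * (k`!%:R * 2 ^+ k)^-1).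
Proof.
rewrite /c_on_B; case: leqP => kn; last by rewrite convsum_eq0// mul0r mulr0.
by rewrite -(mulrA (b p q n)) invfM -mulrA [_ * convsum _ _ _ _]mulrC.
Qed.

Lemma c_on_B_pmf n : B p q n -> is_pmf (c_on_B p q n).
Proof.
move=> Bn; split.
  by move=> k; rewrite c_on_BE !mulr_ge0 ?convsum_ge0 ?invr_ge0 ?b_ge0//.
have <- : \sum_(0 <= k < (n %/ 2).+1) c_on_B p q n k = 1.
  under eq_bigr do rewrite c_on_BE.
  by rewrite -big_distrr/= mulVf// gt_eqF.
apply: series_finite_support => k; rewrite ltn_divLR// mulnC => nk.
by rewrite c_on_BE convsum_eq0// mul0r mulr0.
Qed.

(** For [n] outside [B] both sides are zero, whatever [c n] is. *)
Lemma w_mul_c (c : nat -> nat -> R) theta n k :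
  (forall n, B p q n -> forall k, c n k = c_on_B p q n k) ->
  w p q theta n * c n k =
  (v q theta)^-1 * expR (- u p theta ^+ 2 / 2) * (k`!%:R * 2 ^+ k)^-1 *
    (convsum p q k n * theta ^+ n).
Proof.
move=> cB; rewrite /w; have [Bn|nB] := pselect (B p q n).
  have bn : b p q n != 0 by rewrite gt_eqF.
  have bb : b p q n * (b p q n)^-1 = 1 by rewrite mulfV.
  rewrite cB// c_on_BE; move: bb.
  set x := (v q theta)^-1 * _; set y := (_ * _)^-1; set z := (b p q n)^-1 => bb.
  transitivity (x * y * (convsum p q k n * theta ^+ n) * (b p q n * z)).
    by ring.
  by rewrite bb mulr1.
by rewrite b0_convsum0 ?notB_b0// !(mulr0, mul0r).
Qed.

Lemma w_ge0 theta n : 0 <= theta -> 0 <= v q theta -> 0 <= w p q theta n.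
Proof.
by move=> t0 v0; rewrite /w !mulr_ge0 ?invr_ge0 ?expR_ge0 ?b_ge0 ?exprn_ge0.
Qed.

Lemma series_w_mul_c (c : nat -> nat -> R) theta k :
  p 0%N = 0 -> 0 <= theta -> cvgn (upartial p theta) ->
  cvgn (pseries q theta) -> 0 < v q theta ->
  (forall n, B p q n -> forall k, c n k = c_on_B p q n k) ->
  let eta := u p theta ^+ 2 / 2 in
  series (fun n => w p q theta n * c n k) @ \oo
    --> expR (- eta) * eta ^+ k / k`!%:R.
Proof.
move=> p0 th0 uc vc v0 cB eta; under eq_fun do rewrite (w_mul_c _ _ _ cB).
have -> : expR (- eta) * eta ^+ k / k`!%:R =
    (v q theta)^-1 * expR (- u p theta ^+ 2 / 2) * (k`!%:R * 2 ^+ k)^-1 *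
    (u p theta ^+ (2 * k) * v q theta).
  have k0 : k`!%:R != 0 :> R by rewrite pnatr_eq0 -lt0n fact_gt0.
  rewrite /eta mulNr expr_div_n -exprM; field.
  by rewrite k0 expf_neq0// gt_eqF.
by apply: cvg_seriesMl; exact: pseries_convsum.
Qed.
End Mixing.

Lemma poisson_pmf_cvg (R : realType) (eta : R) :
  series (fun k => expR (- eta) * eta ^+ k / k`!%:R) @ \oo --> (1 : R).
Proof.
under eq_fun do rewrite -mulrA.
have := cvg_seriesMl (c := expR (- eta)) (is_cvg_series_exp_coeff eta).
by rewrite -/(expR eta) [_ * expR eta]mulrC expRxMexpNx_1.
Qed.

(** Integrating the masses of the [c n] against [mu] returns the mass of [mu],
    so [mu] inherits the total mass 1 of the mixture [f]. *)
Lemma mixing_weights_pmf (R : realType) (mu f : nat -> R) (c : nat -> nat -> R) :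
  (forall n, 0 <= mu n) -> (forall n, is_pmf (c n)) ->
  (forall k, series (fun n => mu n * c n k) @ \oo --> f k) ->
  series f @ \oo --> (1 : R) -> is_pmf mu.
Proof.
move=> mu0 cP muc f1; split=> //.
apply: (@nonneg_series_interchange _ (fun k n => mu n * c n k) f) => //.
- by move=> k n; rewrite mulr_ge0//; case: (cP n).
- by move=> n; rewrite -[X in _ --> X]mulr1; apply: cvg_seriesMl; case: (cP n).
Qed.

Theorem theorem8 (R : realType) (p q : nat -> R) (t0 : \bar R)
  (p_ge0 : forall n, 0 <= p n) (q_ge0 : forall n, 0 <= q n)
  (t0_gt0 : (0 < t0)%E)
  (u_cvg : forall t, dom t0 t -> cvgn (upartial p t))
  (v_cvg : forall t, dom t0 t -> cvgn (pseries q t))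
  (p0 : p 0%N = 0)
  (v_neq0 : exists2 t, dom t0 t & v q t != 0)
  (u_lim : left_lim_pinfty t0 (u p))
  (c : nat -> nat -> R)
  (cB : forall n, B p q n -> forall k, c n k = c_on_B p q n k)
  (cNB : forall n, ~ B p q n -> is_pmf (c n)) :
  poisson_mixture_representation c (m p q t0).
Proof.
have c_pmf n : is_pmf (c n).
  have [Bn|/cNB//] := pselect (B p q n).
  by rewrite (_ : c n = c_on_B p q n); [exact: c_on_B_pmf|exact/funext/cB].
have mix k eta : 0 < eta -> (forall n, 0 <= m p q t0 eta n) /\
    series (fun n => m p q t0 eta n * c n k) @ \oo
      --> expR (- eta) * eta ^+ k / k`!%:R.
  move=> eta0; rewrite /m; set y := Num.sqrt _.
  have y0 : 0 < y by rewrite sqrtr_gt0 mulr_gt0.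
  have [] := uinvK (u_surj p_ge0 p0 t0_gt0 u_cvg u_lim (ltW y0)).
  set theta := uinv _ _ _ => dtheta uy.
  have etaE : u p theta ^+ 2 / 2 = eta.
    by rewrite uy sqr_sqrtr ?mulr_ge0 ?(ltW eta0)// mulrC mulKf.
  have theta0 : 0 < theta.
    have [th0 _] := dtheta; rewrite lt0r th0 andbT; apply: contraTneq y0 => th.
    by rewrite -uy th u_at0// ltxx.
  have [t _ vt] := v_neq0.
  have v0 := v_gt0 q_ge0 vt theta0 (v_cvg _ dtheta).
  split; first by move=> n; apply: w_ge0 => //; exact: ltW.
  rewrite -etaE; apply: series_w_mul_c => //.
  - exact: ltW.
  - exact: u_cvg.
  - exact: v_cvg.
split=> //.
- move=> eta eta0.
  apply: (mixing_weights_pmf (c := c) _ _ _ (poisson_pmf_cvg eta)) => //.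
    by case: (mix 0%N eta eta0).
  by move=> k; case: (mix k eta eta0).
- by move=> k eta eta0; case: (mix k eta eta0).
Qed.
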